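(* Let $X$ be a nonempty set, let $F\colon X^2\to X$ be an operation and let $\leq$ be a total ordering on $X$. The following assertions are equivalent. (i) $F$ is quasitrivial, commutative, and $\leq$-preserving. (ii) $F=\max_{\preceq}$ for some total ordering $\preceq$ on $X$ that is single-peaked for $\leq$. If $(X,\leq)=(X_n,\leq_n)$ for some integer $n\geq 1$, then any of the assertions (i)--(ii) is equivalent to any of the following ones. (iii) $F$ is quasitrivial, $\leq$-preserving, and satisfies $\deg_F=(0,2,4,\ldots,2n-2)$. (iv) $F$ is associative, idempotent, commutative, $\leq$-preserving, and has a neutral element. Moreover, there are exactly $2^{n-1}$ operations $F\colon X_n^2\to X_n$ satisfying any of the assertions (i)--(iv) (with $\leq$ equal to $\leq_n$). Furthermore (for $(X,\leq)=(X_n,\leq_n)$), the total ordering $\preceq$ considered in assertion (ii) is uniquely defined as follows: $x\preceq y$ if and only if $\deg_F(x)\leq\deg_F(y)$. In particular, each of these operations has the (unique) neutral element $e=\min_{\preceq}X_n$ and the (unique) annihilator element $a=\max_{\preceq}X_n$.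
   Context: A total ordering on $X$ is a binary relation on $X$ that is total (hence reflexive), transitive, and antisymmetric. $X_n=\{1,\ldots,n\}$ and $\leq_n$ is the total ordering on $X_n$ with $1<_n 2<_n\cdots<_n n$. For a total ordering $\preceq$ on $X$, with strict part $\prec$, $\max_{\preceq}\colon X^2\to X$ is the binary operation giving the larger of its two arguments for $\preceq$; $\min_{\preceq}X_n$ and $\max_{\preceq}X_n$ denote the least and greatest elements of $X_n$ for $\preceq$. Given total orderings $\leq$ and $\preceq$ on $X$, $\preceq$ is single-peaked for $\leq$ if for any $a,b,c\in X$ such that $a<b<c$, we have $b\prec a$ or $b\prec c$. An operation $F\colon X^2\to X$ is: associative if $F(F(x,y),z)=F(x,F(y,z))$ for all $x,y,z$; idempotent if $F(x,x)=x$ for all $x$; quasitrivial if $F(x,y)\in\{x,y\}$ for all $x,y$; commutative if $F(x,y)=F(y,x)$ for all $x,y$; $\leq$-preserving if $x\leq x'$ and $y\leq y'$ imply $F(x,y)\leq F(x',y')$. An element $e$ is a neutral element of $F$ if $F(x,e)=F(e,x)=x$ for all $x\in X$; an element $a$ is an annihilator element of $F$ if $F(x,a)=F(a,x)=a$ for all $x\in X$. For $F\colon X_n^2\to X_n$ and $z\in X_n$, $\deg_F(z)$ is the number of points $(x,y)\in X_n^2\setminus\{(z,z)\}$ such that $F(x,y)=F(z,z)$. The degree sequence $\deg_F$ of $F$ is the nondecreasing $n$-element sequence of the numbers $\deg_F(x)$, $x\in X_n$. *)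

(* Defs.v *)
From mathcomp Require Import all_boot.
From mathcomp Require Import boolp.

Set Implicit Arguments.
Unset Strict Implicit.
Unset Printing Implicit Defensive.

Section Operations.
Variable X : Type.
Implicit Types (F : X -> X -> X) (le prec : rel X).

Definition total_ordering le : Prop :=
  [/\ total le, transitive le & antisymmetric le].

Definition strict le : rel X := fun x y => le x y && ~~ le y x.

Definition max_op le : X -> X -> X := fun x y => if le x y then y else x.

Definition is_least le (m : X) : Prop := forall x, le m x.
Definition is_greatest le (m : X) : Prop := forall x, le x m.

Definition single_peaked le prec : Prop :=
  forall a b c, strict le a b -> strict le b c ->
    strict prec b a \/ strict prec b c.

Definition quasitrivial F : Prop := forall x y, F x y = x \/ F x y = y.

Definition preserving le F : Prop :=
  forall x x' y y', le x x' -> le y y' -> le (F x y) (F x' y').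

Definition neutral F (e : X) : Prop := left_id e F /\ right_id e F.

Definition annihilator F (a : X) : Prop := left_zero a F /\ right_zero a F.

Definition is_single_peaked_max le F prec : Prop :=
  [/\ total_ordering prec, single_peaked le prec & F =2 max_op prec].

Definition assertion_i le F : Prop :=
  [/\ quasitrivial F, commutative F & preserving le F].

Definition assertion_ii le F : Prop :=
  exists prec : rel X, is_single_peaked_max le F prec.

Definition assertion_iv le F : Prop :=
  [/\ associative F, idempotent_op F, commutative F, preserving le F
    & exists e, neutral F e].

End Operations.

Definition deg (T : finType) (F : T -> T -> T) (z : T) : nat :=
  #|[set p : T * T | (p != (z, z)) && (F p.1 p.2 == F z z)]|.

Definition degree_sequence (T : finType) (F : T -> T -> T) : seq nat :=
  sort leq [seq deg F x | x <- enum T].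

(* The chain X_n = {1, ..., n} is represented by 'I_n = {0, ..., n-1}. *)
Definition le_ (n : nat) : rel 'I_n := fun i j => (i <= j)%N.

Definition assertion_iii (n : nat) (F : 'I_n -> 'I_n -> 'I_n) : Prop :=
  [/\ quasitrivial F, preserving (@le_ n) F
    & degree_sequence F = mkseq (fun i => 2 * i)%N n].

(* Number of binary operations on 'I_n satisfying P; finite functions make
   this a genuine cardinality, as they are equal iff pointwise equal. *)
Definition num_ops (n : nat) (P : ('I_n -> 'I_n -> 'I_n) -> Prop) : nat :=
  #|[set f : {ffun 'I_n * 'I_n -> 'I_n} | `[< P (fun x y => f (x, y)) >]]|.

(* Main.v *)
(** Under (i), quasitriviality and monotonicity exclude cycles for the relation
    [F x y = y], which is therefore the required total ordering, and
    single-peakedness says exactly that no value of [F] jumps over an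
    intermediate point.  On a finite chain, the degree of [z] for a maximum
    operation is twice the number of elements strictly below [z]; conversely
    the degree sequence (0, 2, ..., 2n-2) forces, from the largest degree
    downwards, every element to absorb all elements of smaller degree.  The
    operations are counted by recursion: one of the two endpoints of the chain
    is an annihilator, and deleting it yields an arbitrary operation of the
    same kind on the remaining chain. *)

Require Import Defs.
From mathcomp Require Import all_boot.
From mathcomp Require Import boolp.
From mathcomp Require Import zify.

Set Implicit Arguments.
Unset Strict Implicit.
Unset Printing Implicit Defensive.

(** * Maximum operations of total orderings *)

Section TotalOrderings.
Variables (X : Type) (prec : rel X).
Hypothesis prec_total : total_ordering prec.

Lemma total_ordering_refl : reflexive prec.
Proof. by case: prec_total => tot _ _ x; have := tot x x; rewrite orbb. Qed.

Lemma total_orderingNge x y : ~~ prec x y -> prec y x.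
Proof. by case: prec_total => tot _ _; have := tot x y; case: (prec x y). Qed.

Lemma total_ordering_anti x y : prec x y -> prec y x -> x = y.
Proof. by case: prec_total => _ _ anti xy yx; apply: anti; rewrite xy. Qed.

Lemma strictNge x y : strict prec x y = ~~ prec y x.
Proof.
rewrite /strict; case yx: (prec y x); first by rewrite andbF.
by rewrite total_orderingNge ?yx.
Qed.

Lemma max_op_quasitrivial : quasitrivial (max_op prec).
Proof. by move=> x y; rewrite /max_op; case: ifP; [right | left]. Qed.

Lemma max_op_commutative : commutative (max_op prec).
Proof.
move=> x y; rewrite /max_op; case: ifP => xy; case: ifP => yx //.
  exact: total_ordering_anti.
by rewrite total_orderingNge ?xy in yx.
Qed.

Lemma max_op_associative : associative (max_op prec).
Proof.
have [_ trans _] := prec_total; move=> x y z; rewrite /max_op.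
case yz: (prec y z); case xy: (prec x y); rewrite ?yz //.
  by rewrite (trans _ _ _ xy yz).
case: ifP => // xz; have zy := total_orderingNge (negbT yz).
by rewrite (trans _ _ _ xz zy) in xy.
Qed.

Lemma max_op_neutral e : is_least prec e -> neutral (max_op prec) e.
Proof.
move=> least_e; have le_e : left_id e (max_op prec).
  by move=> x; rewrite /max_op least_e.
by split=> // x; rewrite max_op_commutative.
Qed.

Lemma max_op_annihilator a : is_greatest prec a -> annihilator (max_op prec) a.
Proof.
move=> great_a; have ann_a : right_zero a (max_op prec).
  by move=> x; rewrite /max_op great_a.
by split=> // x; rewrite max_op_commutative.
Qed.

End TotalOrderings.

(** * Assertions (i), (ii) and (iv) on an arbitrary chain *)

Section Equivalence.
Variables (X : Type) (le : rel X).
Hypothesis le_total : total_ordering le.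

Lemma neutral_uniq (F : X -> X -> X) e e' : neutral F e -> neutral F e' -> e = e'.
Proof. by move=> [le_e _] [_ re']; rewrite -(re' e) le_e. Qed.

Lemma annihilator_uniq (F : X -> X -> X) a a' :
  annihilator F a -> annihilator F a' -> a = a'.
Proof. by move=> [la _] [_ ra']; rewrite -(la a') ra'. Qed.

Lemma preserving_between F x y : idempotent_op F -> preserving le F ->
  le x y -> le x (F x y) /\ le (F x y) y.
Proof.
move=> idem pres xy; have refl := total_ordering_refl le_total.
by rewrite -{1}(idem x) -{3}(idem y); split; apply: pres.
Qed.

(** With [m] between [p] and [n], monotonicity compares [F p m = m] with [F p n = p], which gives
    the inequality between [m] and [p] opposite to the assumed one. *)
Lemma preserving_no_cycle F p m n : preserving le F ->
    F p m = m -> F m n = n -> F n p = p -> commutative F ->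
    le p m && le m n || le n m && le m p ->
  p = m.
Proof.
move=> pres pm mn np comm; have refl := total_ordering_refl le_total.
rewrite comm in np; have anti := total_ordering_anti le_total.
case/orP=> /andP[le1 le2]; apply: anti => //.
  by rewrite -{1}pm -{2}np; apply: pres.
by rewrite -{1}np -pm; apply: pres.
Qed.

(** The disjuncts are cyclic rotations of the betweenness hypothesis of [preserving_no_cycle], with
    [y], [z] and [x] in the middle in turn. *)
Lemma total_ordering_mid x y z :
  [|| le x y && le y z || le z y && le y x,
      le y z && le z x || le x z && le z y
    | le z x && le x y || le y x && le x z].
Proof.
have [tot _ _] := le_total.
have := tot x y; have := tot y z; have := tot z x.
by case: (le x y); case: (le y x); case: (le y z); case: (le z y);
   case: (le z x); case: (le x z).
Qed.

(** Otherwise [F x z = x], and [x], [y], [z] form a cycle for absorption; whichever of them lies in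
    the middle, two of them coincide. *)
Lemma assertion_i_transitive F x y z : assertion_i le F ->
  F x y = y -> F y z = z -> F x z = z.
Proof.
move=> [quasi comm pres] xy yz; case: (quasi x z) => // xz.
have zx : F z x = x by rewrite comm.
case/or3P: (total_ordering_mid x y z) => mid.
- by rewrite (preserving_no_cycle pres xy yz zx comm mid).
- by rewrite -(preserving_no_cycle pres yz zx xy comm mid).
- by rewrite xz (preserving_no_cycle pres zx xy yz comm mid).
Qed.

Lemma assertion_i_ii F : assertion_i le F -> assertion_ii le F.
Proof.
move=> Fi; have [quasi comm pres] := Fi.
have refl := total_ordering_refl le_total.
(* Equality on [X] need not be decidable, hence the classical Boolean reflection. *)
exists (fun x y => `[< F x y = y >]).
have Fmax : F =2 max_op (fun x y => `[< F x y = y >]).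
  by move=> x y; rewrite /max_op; case: asboolP => // nxy; case: (quasi x y).
have tot : total_ordering (fun x y => `[< F x y = y >]).
  split=> [x y | y x z /asboolP xy /asboolP yz | x y /andP[/asboolP xy /asboolP yx]].
  - apply/orP; case: (quasi x y) => xy; [right | left]; apply/asboolP => //.
    by rewrite comm.
  - by apply/asboolP; apply: assertion_i_transitive xy yz.
  - by rewrite -yx comm.
split=> // a b c; rewrite !(strictNge le_total) => ba cb.
rewrite !(strictNge tot).
case: asboolP => [ab | _]; last by left.
case: asboolP => [cb' | _]; last by right.
have lab := total_orderingNge le_total ba; have lbc := total_orderingNge le_total cb.
(* If [b] absorbs both [a] and [c], then [b = F a b <= F a c <= F b c = b], against quasitriviality
   at [(a, c)]. *)
have : F a c = b.
  apply: (total_ordering_anti le_total); first by rewrite -cb' comm; apply: pres.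
  by rewrite -{1}ab; apply: pres.
by case: (quasi a c) => -> eq_b; move: ba cb; rewrite eq_b refl.
Qed.

Lemma assertion_ii_i F : assertion_ii le F -> assertion_i le F.
Proof.
move=> [prec [tot peak Fmax]].
have -> : F = max_op prec by apply/funext => x; apply/funext => y.
have comm := max_op_commutative tot.
have [_ trans _] := tot; have [_ letrans _] := le_total.
have anti := total_ordering_anti tot; have refl := total_ordering_refl le_total.
(* By commutativity, monotonicity in the second argument suffices. *)
suff pres x y z : le y z -> le (max_op prec x y) (max_op prec x z).
  split=> // [|x x' y y' xx' yy']; first exact: max_op_quasitrivial.
  apply: letrans (pres _ _ _ yy') _.
  by rewrite comm (comm x'); apply: pres.
move=> yz; rewrite /max_op.
(* In the two mixed cases, a failure of monotonicity with [y] and [z] distinct makes the [le]-middle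
   one of [x], [y], [z] dominate the other two for [prec], against single-peakedness. *)
case xy: (prec x y); case xz: (prec x z) => //; apply: contraT => Nle.
- have zx := total_orderingNge tot (negbT xz).
  case zy: (le z y).
    have eq_yz := total_ordering_anti le_total yz zy.
    by rewrite -eq_yz xy in xz.
  have := peak x y z; rewrite !(strictNge le_total) !(strictNge tot) zy Nle.
  by rewrite xy (trans _ _ _ zx xy) => /(_ isT isT) [].
- have yx := total_orderingNge tot (negbT xy).
  case zy: (le z y).
    have eq_yz := total_ordering_anti le_total yz zy.
    by rewrite eq_yz xz in xy.
  have := peak y z x; rewrite !(strictNge le_total) !(strictNge tot) zy Nle.
  by rewrite xz (trans _ _ _ yx xz) => /(_ isT isT) [].
Qed.

(** [F] is the minimum below [e] and the maximum above it. For [x <= y] the value lies in between: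
    if [F x y <= e], then [F x y = F x (F x y) = x]; otherwise [F x y = F (F x y) y = y]. *)
Lemma assertion_iv_i F : assertion_iv le F -> assertion_i le F.
Proof.
move=> [assoc idem comm pres [e [le_e re_e]]]; split=> //.
have refl := total_ordering_refl le_total.
have anti := total_ordering_anti le_total.
have btw x y := @preserving_between F x y idem pres.
have low x y : le x y -> le y e -> F x y = x.
  move=> xy ye; apply: anti; last by case: (btw _ _ xy).
  by rewrite -[X in le _ X]re_e; apply: pres.
have high x y : le e x -> le x y -> F x y = y.
  move=> ex xy; apply: anti; first by case: (btw _ _ xy).
  by rewrite -[X in le X _]le_e; apply: pres.
suff quasi x y : le x y -> F x y = x \/ F x y = y.
  move=> x y; case xy: (le x y); first exact: quasi.
  have yx := total_orderingNge le_total (negbT xy).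
  by rewrite comm; case: (quasi _ _ yx); [right | left].
move=> xy; have [xz zy] := btw _ _ xy.
case ze: (le (F x y) e).
  by left; rewrite -[RHS](low x (F x y)) // assoc idem.
have ez := total_orderingNge le_total (negbT ze).
by right; rewrite -[RHS](high (F x y) y) // -assoc idem.
Qed.

End Equivalence.

(** * Degrees of a maximum operation on a finite set *)

Section Degrees.
Variable T : finType.
Implicit Types (F : T -> T -> T) (prec : rel T).

(** The shape of the fibre over [z], without [(z, z)], when the elements absorbed by [z] are those
    of [S]. *)
Definition cross (z : T) (S : {set T}) : {set T * T} :=
  setX [set z] S :|: setX S [set z].

Lemma in_cross z (S : {set T}) x y :
  ((x, y) \in cross z S) = (x == z) && (y \in S) || (x \in S) && (y == z).
Proof. by rewrite !inE. Qed.

Lemma card_cross z (S : {set T}) : z \notin S -> #|cross z S| = 2 * #|S|.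
Proof.
move=> zS; rewrite cardsU !cardsX cards1 mul1n muln1.
suff -> : setX [set z] S :&: setX S [set z] = set0 by rewrite cards0; lia.
apply/setP => -[x y]; rewrite !inE.
by apply/negbTE/negP => /andP[/andP[/eqP-> _] /andP[]]; rewrite (negbTE zS).
Qed.

Definition below prec z := [set y | strict prec y z].

Section MaxOperation.
Variables (F : T -> T -> T) (prec : rel T).
Hypotheses (tot : total_ordering prec) (Fmax : F =2 max_op prec).

(** A maximum equals [z] exactly when one argument is [z] and the other is not above it, so the
    pairs counted form the cross of [z] with [below prec z]. *)
Lemma deg_max_op z : deg F z = 2 * #|below prec z|.
Proof.
have refl := total_ordering_refl tot.
rewrite -(@card_cross z); last by rewrite inE /strict andbN.
apply: eq_card => -[x y]; rewrite in_cross !inE /=.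
rewrite !Fmax !(strictNge tot) /max_op refl xpair_eqE.
have [-> | nxz] := eqVneq x z; have [-> | nyz] := eqVneq y z.
- by rewrite refl.
- rewrite refl /=; case: ifP => //= zy; rewrite ?eqxx ?(negbTE nyz) //.
- by rewrite refl /= andbT; case: ifP => xz; rewrite ?eqxx ?(negbTE nxz);
    apply/esym; case zx: (prec z x) => //=;
    [rewrite (total_ordering_anti tot xz zx) eqxx in nxz
    |rewrite total_orderingNge ?zx in xz].
- by rewrite /= andbF; case: ifP; rewrite ?(negbTE nxz) ?(negbTE nyz).
Qed.

(** The sets [below prec z] are nested along [prec]; when [y] is strictly below [x], [y] itself
    shows that the inclusion is proper. *)
Lemma leq_deg_max_op x y : (deg F x <= deg F y) = prec x y.
Proof.
have [_ trans _] := tot; rewrite !deg_max_op leq_pmul2l //.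
case xy: (prec x y).
  apply/subset_leq_card/subsetP => z; rewrite !inE !(strictNge tot).
  by apply: contra; apply: trans.
apply/negbTE; rewrite -ltnNge; apply/proper_card/properP.
have yx := total_orderingNge tot (negbT xy); split; last first.
  by exists y; rewrite inE (strictNge tot) ?xy // (total_ordering_refl tot).
apply/subsetP => z; rewrite !inE !(strictNge tot).
by apply: contra; apply: trans.
Qed.

(** The rank [r] is injective with values less than [#|T|], so it takes each of them once; degrees
    are doubled ranks. *)
Lemma degree_sequence_max_op :
  degree_sequence F = mkseq (fun i => 2 * i) #|T|.
Proof.
pose r z := #|below prec z|.
have r_inj : injective r.
  move=> x y eq_r; apply: (total_ordering_anti tot);
  by rewrite -leq_deg_max_op !deg_max_op -!/(r _) eq_r.
have r_lt z : r z < #|T|.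
  rewrite /r -cardsT; apply/proper_card/properP; split; first exact: subsetT.
  by exists z; rewrite ?inE // /strict andbN.
have r_perm : perm_eq [seq r x | x <- enum T] (iota 0 #|T|).
  have u : uniq [seq r x | x <- enum T] by rewrite map_inj_uniq ?enum_uniq.
  have sub : {subset [seq r x | x <- enum T] <= iota 0 #|T|}.
    by move=> _ /mapP[z _ ->]; rewrite mem_iota r_lt.
  apply: uniq_perm => //; first exact: iota_uniq.
  by case: (uniq_min_size u sub); rewrite // size_iota size_map -cardE.
have -> : mkseq (fun i => 2 * i) #|T| = sort leq (mkseq (fun i => 2 * i) #|T|).
  apply/esym/sorted_sort; first exact: leq_trans.
  rewrite sorted_map; apply: sub_sorted (iota_sorted _ _) => i j /=.
  by rewrite leq_pmul2l.
apply/perm_sortP; [exact: leq_total | exact: leq_trans | exact: anti_leq |].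
have -> : [seq deg F x | x <- enum T] = [seq 2 * i | i <- [seq r x | x <- enum T]].
  by rewrite -map_comp; apply: eq_map => z; rewrite /= deg_max_op.
exact: perm_map.
Qed.

End MaxOperation.

(** * Absorption forced by the degree sequence *)

Lemma degree_sequence_perm F : degree_sequence F = mkseq (fun i => 2 * i) #|T| ->
  perm_eq [seq deg F x | x <- enum T] [seq 2 * i | i <- iota 0 #|T|].
Proof. by rewrite /mkseq => <-; rewrite perm_sym perm_sort. Qed.

Lemma deg_inj F : degree_sequence F = mkseq (fun i => 2 * i) #|T| ->
  injective (deg F).
Proof.
move=> /degree_sequence_perm perm_deg x y.
have : uniq [seq deg F x | x <- enum T].
  rewrite (perm_uniq perm_deg) map_inj_uniq ?iota_uniq // => i j; lia.
by move=> /injectiveP; apply.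
Qed.

(** If [deg F x = 2 * k], the smaller entries of the sequence are the [2 * i] with [i < k], so
    exactly [k] elements have smaller degree. *)
Lemma card_deg_lt F x : degree_sequence F = mkseq (fun i => 2 * i) #|T| ->
  deg F x = 2 * #|[set y | deg F y < deg F x]|.
Proof.
move=> /degree_sequence_perm perm_deg.
have : deg F x \in [seq 2 * i | i <- iota 0 #|T|].
  by rewrite -(perm_mem perm_deg) map_f ?mem_enum.
case/mapP => k; rewrite mem_iota add0n => /= lt_k eq_k.
rewrite {1}eq_k; congr (2 * _).
have /permP/(_ [pred d | d < deg F x]) := perm_deg.
rewrite !count_map eq_k.
rewrite (eq_count (a2 := [pred i | i < k])) => [|i]; last first.
  by rewrite /= ltn_pmul2l.
have -> : count [pred i | i < k] (iota 0 #|T|) = k.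
  rewrite -(subnKC (ltnW lt_k)) iotaD count_cat add0n.
  rewrite (eq_in_count (a2 := predT)) => [|i]; last first.
    by rewrite mem_iota add0n => /andP[_ /= ->].
  rewrite count_predT size_iota.
  rewrite (eq_in_count (a2 := pred0)) => [|i]; last first.
    by rewrite mem_iota => /andP[ki _] /=; apply/negbTE; rewrite -leqNgt.
  by rewrite count_pred0 addn0.
move=> eq_count_k; rewrite -[LHS]eq_count_k cardE /enum_mem size_filter -enumT.
by apply: eq_count => y; rewrite /= inE.
Qed.

Lemma degree_sequence_absorb F : quasitrivial F ->
    degree_sequence F = mkseq (fun i => 2 * i) #|T| ->
  forall x y, deg F y <= deg F x -> F x y = x /\ F y x = x.
Proof.
move=> quasi degF; have dinj := deg_inj degF.
have Fid x : F x x = x by case: (quasi x x).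
pose m := \max_x deg F x.
have le_m x : deg F x <= m by exact: leq_bigmax.
(* Induction on a bound for [m - deg F x] treats the elements of larger degree first. *)
suff absorb k x : m - deg F x < k ->
    forall y, deg F y <= deg F x -> F x y = x /\ F y x = x.
  by move=> x; apply: (absorb (m - deg F x).+1).
elim: k x => // k IH x lt_k y.
rewrite leq_eqVlt => /orP[/eqP/dinj-> | lt_yx]; first by rewrite Fid.
pose S := [set y | deg F y < deg F x].
(* Elements of larger degree already absorb [x], so by quasitriviality the fibre lies in the cross.
   Both have the same cardinality by [card_deg_lt], and their equality says that [x] absorbs all of
   [S]. *)
have eq_fib : [set p : T * T | (p != (x, x)) && (F p.1 p.2 == F x x)] = cross x S.
  apply/eqP; rewrite eqEcard card_cross ?inE ?ltnn // -card_deg_lt // leqnn andbT.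
  have large u : u != x -> u \notin S -> F x u = u /\ F u x = u.
    move=> nux; rewrite inE -leqNgt => le_xu.
    have lt_xu : deg F x < deg F u.
      by rewrite ltn_neqAle le_xu andbT; apply: contra nux => /eqP/dinj->.
    by have [] // := IH u _ x le_xu; have := le_m u; lia.
  apply/subsetP => -[u v]; rewrite in_cross inE /= Fid xpair_eqE.
  case/andP => nuv /eqP Fuv.
  have [eu | nu] := eqVneq u x.
    rewrite eu eqxx /= in nuv Fuv *; apply/orP; left.
    apply: contraT => /(large _ nuv)[Fxv _].
    by rewrite -Fuv Fxv eqxx in nuv.
  have [ev | nv] := eqVneq v x.
    rewrite ev /= andbT in Fuv *; apply: contraT => /(large _ nu)[_ Fux].
    by rewrite -Fuv Fux eqxx in nu.
  by case: (quasi u v) => e; move: nu nv; rewrite -Fuv e eqxx.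
have yS : y \in S by rewrite inE.
split.
  have : (x, y) \in cross x S by rewrite in_cross eqxx yS.
  by rewrite -eq_fib inE /= Fid => /andP[_ /eqP].
have : (y, x) \in cross x S by rewrite in_cross eqxx yS orbT.
by rewrite -eq_fib inE /= Fid => /andP[_ /eqP].
Qed.

Lemma degree_sequence_commutative F : quasitrivial F ->
  degree_sequence F = mkseq (fun i => 2 * i) #|T| -> commutative F.
Proof.
move=> quasi degF x y.
by case: (leqP (deg F x) (deg F y)) => [|/ltnW] le_deg;
  have [-> ->] := degree_sequence_absorb quasi degF le_deg.
Qed.

(** The degree is a numerical measure of [prec], so its extrema are attained where the degree is
    extremal. *)
Lemma max_op_extrema (x0 : T) F prec : total_ordering prec -> F =2 max_op prec ->
  (exists e, is_least prec e) /\ (exists a, is_greatest prec a).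
Proof.
move=> tot Fmax; split.
  exists [arg min_(x < x0) deg F x] => y; rewrite -(leq_deg_max_op tot Fmax).
  by case: arg_minnP => // i _; apply.
exists [arg max_(x > x0) deg F x] => y; rewrite -(leq_deg_max_op tot Fmax).
by case: arg_maxnP => // i _; apply.
Qed.

End Degrees.

Lemma le_total_ordering n : total_ordering (@le_ n).
Proof.
split=> [x y | y x z | x y]; rewrite /le_; first exact: leq_total.
  exact: leq_trans.
by move=> /anti_leq/val_inj.
Qed.

(** * Counting by removal of the annihilator *)

Section Counting.
Variable n : nat.
Implicit Types (a : 'I_n.+2) (f : {ffun 'I_n.+2 * 'I_n.+2 -> 'I_n.+2}).
Implicit Types (g : {ffun 'I_n.+1 * 'I_n.+1 -> 'I_n.+1}).

Definition adjoin a g : {ffun 'I_n.+2 * 'I_n.+2 -> 'I_n.+2} :=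
  [ffun p => if (unlift a p.1, unlift a p.2) is (Some x, Some y)
             then lift a (g (x, y)) else a].

(** The default [ord0] matters only if [f] sends two points other than [a] to [a], which
    quasitriviality excludes. *)
Definition delete a f : {ffun 'I_n.+1 * 'I_n.+1 -> 'I_n.+1} :=
  [ffun p => odflt ord0 (unlift a (f (lift a p.1, lift a p.2)))].

Lemma adjoin_lift a g x y : adjoin a g (lift a x, lift a y) = lift a (g (x, y)).
Proof. by rewrite ffunE /= !liftK. Qed.

Lemma adjoin_annihilator a g : annihilator (fun x y => adjoin a g (x, y)) a.
Proof. by split=> x; rewrite ffunE /= unlift_none //; case: (unlift a x). Qed.

Lemma adjoinK a : cancel (adjoin a) (delete a).
Proof. by move=> g; apply/ffunP => -[x y]; rewrite ffunE /= adjoin_lift liftK. Qed.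

Lemma adjoin_a_inj a a' g g' : adjoin a g = adjoin a' g' -> a = a'.
Proof.
move=> eq_adj; apply: annihilator_uniq (adjoin_annihilator a g) _.
by rewrite eq_adj; apply: adjoin_annihilator.
Qed.

Lemma deleteK a f : quasitrivial (fun x y => f (x, y)) ->
  annihilator (fun x y => f (x, y)) a -> adjoin a (delete a f) = f.
Proof.
move=> quasi [la ra]; have [la' ra'] := adjoin_annihilator a (delete a f).
apply/ffunP => -[x y].
case: (unliftP a x) => [x'|] ->; last by rewrite la la'.
case: (unliftP a y) => [y'|] ->; last by rewrite ra ra'.
rewrite adjoin_lift ffunE /=.
by case: (quasi (lift a x') (lift a y')) => /= ->; rewrite liftK.
Qed.

Lemma leq_lift (a : 'I_n.+2) (x y : 'I_n.+1) : (lift a x <= lift a y) = (x <= y).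
Proof. by rewrite /= leq_bump2. Qed.

(** For monotonicity, if [a] is least, a larger pair avoids [a] whenever the smaller one does; if
    [a] is greatest, the converse holds. This leaves pairs avoiding [a], where [g] is monotone. *)
Lemma assertion_i_adjoin a g : a = ord0 \/ a = ord_max ->
  assertion_i (@le_ n.+1) (fun x y => g (x, y)) ->
  assertion_i (@le_ n.+2) (fun x y => adjoin a g (x, y)).
Proof.
move=> ext_a [quasi comm pres].
have [la ra] := adjoin_annihilator a g; split.
- move=> x y; case: (unliftP a x) => [x'|] ->; last by left; rewrite la.
  case: (unliftP a y) => [y'|] ->; last by right; rewrite ra.
  by rewrite adjoin_lift; case: (quasi x' y') => /= ->; [left | right].
- move=> x y; case: (unliftP a x) => [x'|] ->; last by rewrite la ra.
  case: (unliftP a y) => [y'|] ->; last by rewrite la ra.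
  by rewrite !adjoin_lift comm.
- move=> x x' y y'; rewrite /le_.
  case: ext_a => ea.
    case: (unliftP a x) => [u|] ->; last by rewrite la ea.
    case: (unliftP a y) => [v|] ->; last by rewrite ra ea.
    case: (unliftP a x') => [u'|] ->; last by rewrite ea.
    case: (unliftP a y') => [v'|] ->; last by rewrite ea.
    by rewrite !adjoin_lift !leq_lift; apply: pres.
  have le_a (z : 'I_n.+2) : z <= a by rewrite ea; apply: leq_ord.
  have lift_lt z : (a <= lift a z) = false.
    by apply/negbTE; rewrite -ltnNge ltn_neqAle le_a eq_sym neq_lift.
  case: (unliftP a x') => [u'|] ->; last by rewrite la le_a.
  case: (unliftP a y') => [v'|] ->; last by rewrite ra le_a.
  case: (unliftP a x) => [u|] ->; last by rewrite lift_lt.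
  case: (unliftP a y) => [v|] ->; last by rewrite lift_lt.
  by rewrite !adjoin_lift !leq_lift; apply: pres.
Qed.

Lemma assertion_i_delete a f :
    assertion_i (@le_ n.+2) (fun x y => f (x, y)) ->
    annihilator (fun x y => f (x, y)) a ->
  assertion_i (@le_ n.+1) (fun x y => delete a f (x, y)).
Proof.
move=> [quasi comm pres] ann_a; have fK := deleteK quasi ann_a.
have lift_delete x y : lift a (delete a f (x, y)) = f (lift a x, lift a y).
  by rewrite -adjoin_lift fK.
split=> [x y | x y | x x' y y' xx' yy'].
- by case: (quasi (lift a x) (lift a y)) => /=; rewrite -lift_delete => /lift_inj;
    [left | right].
- by apply: (@lift_inj _ a); rewrite !lift_delete comm.
- by rewrite /le_ -(leq_lift a) !lift_delete; apply: pres; rewrite /le_ leq_lift.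
Qed.

(** The value at [(ord0, ord_max)] is one of the two endpoints; monotonicity spreads it over a whole
    row or column of the table, and commutativity over the other. *)
Lemma assertion_i_annihilator f : assertion_i (@le_ n.+2) (fun x y => f (x, y)) ->
  exists2 a, a = ord0 \/ a = ord_max & annihilator (fun x y => f (x, y)) a.
Proof.
move=> [quasi comm pres]; case: (quasi ord0 ord_max) => /= f0m.
  exists ord0; first by left.
  suff l0 : left_zero ord0 (fun x y => f (x, y)) by split=> // x; rewrite comm.
  move=> x; apply/val_inj/eqP; rewrite -leqn0 -[X in _ <= X]/(val (@ord0 n.+1)).
  rewrite -[X in _ <= val X]f0m.
  by apply: pres; rewrite /le_ ?leqnn ?leq_ord.
exists ord_max; first by right.
suff rm : right_zero ord_max (fun x y => f (x, y)) by split=> // x; rewrite comm.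
move=> x; apply/val_inj/eqP; rewrite eqn_leq leq_ord -{1}f0m.
by apply: pres; rewrite /le_.
Qed.

(** The operations split according to their annihilator, [ord0] or [ord_max]; each class is an
    injective image of the operations on the shorter chain, and uniqueness of the annihilator makes
    the classes disjoint. *)
Lemma num_ops_assertion_i_rec :
  num_ops (assertion_i (@le_ n.+2)) = 2 * num_ops (assertion_i (@le_ n.+1)).
Proof.
rewrite /num_ops; set A := [set g : {ffun 'I_n.+1 * _ -> _} | _].
have -> : [set f : {ffun 'I_n.+2 * 'I_n.+2 -> 'I_n.+2} |
             `[< assertion_i (@le_ n.+2) (fun x y => f (x, y)) >]]
          = adjoin ord0 @: A :|: adjoin ord_max @: A.
  apply/setP => f; rewrite !inE; apply/asboolP/idP => [fi|].
    have [a ext_a ann_a] := assertion_i_annihilator fi.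
    have fK : adjoin a (delete a f) = f by apply: deleteK => //; case: fi.
    have del_A : delete a f \in A.
      by rewrite inE; apply/asboolP/assertion_i_delete.
    by case: ext_a => ea; rewrite -fK; apply/orP; [left | right];
       rewrite {1}ea imset_f.
  case/orP=> /imsetP[g]; rewrite inE => /asboolP gi ->;
    apply: assertion_i_adjoin => //; [by left | by right].
rewrite cardsU !card_imset; try exact: can_inj (@adjoinK _).
suff -> : adjoin ord0 @: A :&: adjoin ord_max @: A = set0 by rewrite cards0; lia.
apply/setP => f; rewrite !inE; apply/negP => /andP[/imsetP[g _ ->] /imsetP[g' _]].
by move/adjoin_a_inj/(congr1 val).
Qed.

End Counting.

Lemma num_ops_assertion_i n : num_ops (assertion_i (@le_ n.+1)) = 2 ^ n.
Proof.
elim: n => [|n IH]; last by rewrite num_ops_assertion_i_rec IH expnS.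
rewrite /num_ops expn0; apply/eqP/cards1P; exists [ffun=> ord0].
apply/setP => f; rewrite !inE; apply/asboolP/eqP => [_ | _].
  by apply/ffunP => p; rewrite ffunE ord1.
split=> [x y | x y | x x' y y' _ _]; rewrite ?(ord1 x) ?(ord1 y) //.
  by left; apply: ord1.
by rewrite /le_ !ord1.
Qed.

Lemma eq_num_ops n (P Q : ('I_n -> 'I_n -> 'I_n) -> Prop) :
  (forall F, P F <-> Q F) -> num_ops P = num_ops Q.
Proof. by move=> PQ; apply: eq_card => f; rewrite !inE; apply: asbool_equiv_eq. Qed.

(** * The four assertions on a finite chain *)

Section Chain.
Variable n : nat.
Implicit Type F : 'I_n.+1 -> 'I_n.+1 -> 'I_n.+1.

Lemma assertion_ii_iii F : assertion_ii (@le_ n.+1) F -> assertion_iii F.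
Proof.
move=> Fii; have [quasi _ pres] := assertion_ii_i (le_total_ordering _) Fii.
have [prec [tot _ Fmax]] := Fii; split=> //.
by rewrite (degree_sequence_max_op tot Fmax) card_ord.
Qed.

Lemma assertion_iii_iv F : assertion_iii F -> assertion_iv (@le_ n.+1) F.
Proof.
move=> [quasi pres degF].
have comm : commutative F.
  by apply: degree_sequence_commutative => //; rewrite card_ord.
(* With commutativity (i) holds, so [F] is a maximum operation, which supplies associativity and the
   neutral element. *)
have [prec [tot _ Fmax]] : assertion_ii (@le_ n.+1) F.
  by apply: assertion_i_ii; [apply: le_total_ordering | split].
have [[e /(max_op_neutral tot)[le_e re_e]] _] := max_op_extrema ord0 tot Fmax.
split=> //.
- by move=> x y z; rewrite !Fmax max_op_associative.
- by move=> x; case: (quasi x x).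
- by exists e; split=> x; rewrite Fmax.
Qed.

Lemma assertions_equivalent F :
  [<-> assertion_i (@le_ n.+1) F; assertion_ii (@le_ n.+1) F;
       assertion_iii F; assertion_iv (@le_ n.+1) F].
Proof.
tfae.
- exact: assertion_i_ii (le_total_ordering _) _.
- exact: assertion_ii_iii.
- exact: assertion_iii_iv.
- exact: assertion_iv_i (le_total_ordering _) _.
Qed.

End Chain.

Theorem theorem3p7 :
  (forall (X : Type) (F : X -> X -> X) (le : rel X),
     inhabited X -> total_ordering le ->
     (assertion_i le F <-> assertion_ii le F))
  /\
  (forall n : nat, (1 <= n)%N ->
     [/\ forall F : 'I_n -> 'I_n -> 'I_n,
           [<-> assertion_i (@le_ n) F;
                assertion_ii (@le_ n) F;
                assertion_iii F;
                assertion_iv (@le_ n) F],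
         [/\ num_ops (assertion_i (@le_ n)) = (2 ^ (n - 1))%N,
             num_ops (assertion_ii (@le_ n)) = (2 ^ (n - 1))%N,
             num_ops (@assertion_iii n) = (2 ^ (n - 1))%N
           & num_ops (assertion_iv (@le_ n)) = (2 ^ (n - 1))%N],
         forall F : 'I_n -> 'I_n -> 'I_n, assertion_ii (@le_ n) F ->
           forall prec : rel 'I_n,
             is_single_peaked_max (@le_ n) F prec
             <-> (forall x y, prec x y = (deg F x <= deg F y)%N)
       & forall (F : 'I_n -> 'I_n -> 'I_n) (prec : rel 'I_n),
           is_single_peaked_max (@le_ n) F prec ->
           exists e a : 'I_n,
             [/\ is_least prec e, unique (neutral F) e,
                 is_greatest prec a & unique (annihilator F) a]]).
Proof.
split=> [X F le _ le_tot | [//|n] _].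
  by split; [apply: assertion_i_ii | apply: assertion_ii_i].
split=> [F | | F [prec0 [tot0 peak0 Fmax0]] prec | F prec [tot _ Fmax]].
- exact: assertions_equivalent.
- have count_eq P : (forall F, assertion_i (@le_ n.+1) F <-> P F) ->
    num_ops P = (2 ^ (n.+1 - 1))%N.
    by move=> /eq_num_ops <-; rewrite num_ops_assertion_i subn1.
  by split; apply: count_eq => F; [| exact: (assertions_equivalent F 0 1)
    | exact: (assertions_equivalent F 0 2) | exact: (assertions_equivalent F 0 3)].
- split=> [[tot _ Fmax] x y | prec_deg].
    by rewrite (leq_deg_max_op tot Fmax).
  (* Both relations are given by comparison of degrees, so [prec] inherits the properties of
     [prec0]. *)
  suff -> : prec = prec0 by [].
  apply/funext => x; apply/funext => y.
  by rewrite prec_deg (leq_deg_max_op tot0 Fmax0).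
- have [[e least_e] [a great_a]] := max_op_extrema ord0 tot Fmax.
  have eq_F : F = max_op prec by apply/funext => x; apply/funext => y.
  have ne := max_op_neutral tot least_e; have aa := max_op_annihilator tot great_a.
  exists e, a; rewrite eq_F; split=> //; split=> // z nz.
    exact: neutral_uniq ne nz.
  exact: annihilator_uniq aa nz.
Qed.
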